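(* Let $G$ be a group and $M$ a $G$-module. For every $n\geq 0$ the homomorphism $\gamma^n:H^n_\lambda(G,M)\to HS^n(G,M)$ is a split monomorphism. Moreover, it is an isomorphism provided $M$ has no elements of order two.
   Context: Let $G$ be a group and $M$ a (left) $G$-module. Homogeneous cochains: $K^n(G,M)$ is the group of functions $f:G^{n+1}\to M$ with $f(sg_0,\dots,sg_n)=s\cdot f(g_0,\dots,g_n)$, with differential $(\partial f)(g_0,\dots,g_{n+1})=\sum_{j=0}^{n+1}(-1)^j f(g_0,\dots,\widehat{g_j},\dots,g_{n+1})$. $KS^*(G,M)\subset K^*(G,M)$ is the subcomplex of those $f\in K^n(G,M)$ with $f(g_0,\dots,g_i,g_{i+1},\dots,g_n)=-f(g_0,\dots,g_{i+1},g_i,\dots,g_n)$ for all $0\le i<n$. $K^*_\lambda(G,M)\subset KS^*(G,M)$ is the subcomplex of those $f\in KS^n(G,M)$ which in addition satisfy $f(g_0,\dots,g_n)=0$ whenever $g_i=g_{i+1}$ for some $0\le i<n$. The exterior cohomology is $H^n_\lambda(G,M)=H^n(K^*_\lambda(G,M))$. Inhomogeneous cochains: $C^n(G,M)$ is the group of all functions $\phi:G^n\to M$ with the standard differential $\partial\phi(g_0,\dots,g_n)=g_0\phi(g_1,\dots,g_n)+\sum_{j=1}^n(-1)^j\phi(g_0,\dots,g_{j-1}g_j,\dots,g_n)+(-1)^{n+1}\phi(g_0,\dots,g_{n-1})$. The symmetric group $\Sigma_{n+1}$ acts on $C^n(G,M)$, the transposition $\tau_i=(i,i+1)$ acting by $(\tau_1\phi)(g_1,\dots,g_n)=-g_1\phi(g_1^{-1},g_1g_2,g_3,\dots,g_n)$;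 $(\tau_i\phi)(g_1,\dots,g_n)=-\phi(g_1,\dots,g_{i-2},g_{i-1}g_i,g_i^{-1},g_ig_{i+1},\dots,g_n)$ for $1<i<n$; and $(\tau_n\phi)(g_1,\dots,g_n)=-\phi(g_1,\dots,g_{n-1}g_n,g_n^{-1})$ for $n>1$. The invariants $CS^n(G,M)=C^n(G,M)^{\Sigma_{n+1}}$ form a subcomplex of $C^*(G,M)$, and the symmetric cohomology is $HS^n(G,M)=H^n(CS^*(G,M))$. The isomorphism of complexes $\psi:K^*(G,M)\to C^*(G,M)$, $\psi^n(f)(g_1,\dots,g_n)=f(1,g_1,g_1g_2,\dots,g_1\cdots g_n)$, restricts to an isomorphism $KS^*(G,M)\to CS^*(G,M)$. The map $\gamma^n:H^n_\lambda(G,M)\to HS^n(G,M)$ is the map induced on cohomology by the inclusion $K^*_\lambda(G,M)\hookrightarrow KS^*(G,M)$ followed by $\psi:KS^*(G,M)\cong CS^*(G,M)$. *)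

(* Defs.v *)
From HB Require Import structures.
From mathcomp Require Import all_boot perm action all_algebra.
From mathcomp Require Import generic_quotient ring_quotient zify.
From mathcomp Require Import boolp functions.

Set Implicit Arguments.
Unset Strict Implicit.
Unset Printing Implicit Defensive.

Import GRing.Theory.
Local Open Scope ring_scope.
Local Open Scope quotient_scope.

Section SubZmodule.
Variables (V : zmodType) (S : zmodClosed V).

Definition subzmod : Type := {x : V | x \in S}.
HB.instance Definition _ := SubChoice.on subzmod.
HB.instance Definition _ := [SubChoice_isSubZmodule of subzmod by <:].

End SubZmodule.

Section SubMap.
Variables (U V : zmodType) (S : zmodClosed U) (T : zmodClosed V).
Variables (f : {additive U -> V}) (fST : forall x, x \in S -> f x \in T).

Definition submap (x : subzmod S) : subzmod T := exist _ (f (val x)) (fST (valP x)).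

Fact submap_is_zmod_morphism : zmod_morphism submap.
Proof. by move=> x y; apply/val_inj; rewrite /= !raddfB. Qed.
HB.instance Definition _ :=
  GRing.isZmodMorphism.Build _ _ submap submap_is_zmod_morphism.

End SubMap.

Section QuotientMap.
Variables (U V : zmodType) (S : zmodClosed U) (T : zmodClosed V).
Variable f : {additive U -> V}.

(* The unused argument fST lets the additive structure be inferred. *)
Definition quotmap (fST : forall x, x \in S -> f x \in T)
  (q : Quotient.quot S) : Quotient.quot T := \pi_(Quotient.quot T) (f (repr q)).

Hypothesis fST : forall x, x \in S -> f x \in T.

Lemma quotmap_pi x :
  quotmap fST (\pi_(Quotient.quot S) x) = \pi_(Quotient.quot T) (f x).
Proof.
apply/eqP; rewrite -Quotient.idealrBE -raddfB; apply: fST.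
by rewrite Quotient.idealrBE reprK.
Qed.

Fact quotmap_is_zmod_morphism : zmod_morphism (quotmap fST).
Proof.
by move=> x y; rewrite -[x]reprK -[y]reprK -raddfB !quotmap_pi !raddfB.
Qed.
HB.instance Definition _ :=
  GRing.isZmodMorphism.Build _ _ (quotmap fST) quotmap_is_zmod_morphism.

End QuotientMap.

Record cochain_complex := CochainComplex {
  cobj :> nat -> zmodType;
  cdiff : forall n, {additive cobj n -> cobj n.+1};
  cdiffK : forall n (x : cobj n), cdiff n.+1 (cdiff n x) = 0 }.

Arguments cdiff {_ _}.

Record cochain_map (C D : cochain_complex) := CochainMap {
  cmap :> forall n, {additive C n -> D n};
  cmapE : forall n (x : C n), cmap n.+1 (cdiff x) = cdiff (cmap n x) }.

Definition is_coboundary (C : cochain_complex) (n : nat) : C n -> Prop :=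
  match n with
  | 0 => fun x => x = 0
  | m.+1 => fun x => exists y : C m, x = cdiff y
  end.

Fact is_coboundary0 (C : cochain_complex) n : @is_coboundary C n 0.
Proof. by case: n => [|m] //; exists 0; rewrite raddf0. Qed.

Fact is_coboundaryB (C : cochain_complex) n (x y : C n) :
  is_coboundary x -> is_coboundary y -> is_coboundary (x - y).
Proof.
case: n x y => [|m] x y /=; first by move=> -> ->; rewrite subrr.
by move=> [x' ->] [y' ->]; exists (x' - y'); rewrite raddfB.
Qed.

Fact is_coboundary_map (C D : cochain_complex) (f : cochain_map C D) n (x : C n) :
  is_coboundary x -> is_coboundary (f n x).
Proof.
case: n x => [|m] x /= => [->|[y ->]]; first by rewrite raddf0.
by exists (f m y); rewrite cmapE.
Qed.

Section Cohomology.
Variables (C : cochain_complex) (n : nat).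

Definition cocycle : {pred C n} := fun x => cdiff x == 0.
Fact cocycle_zmod_closed : zmod_closed cocycle.
Proof.
split=> [|x y]; rewrite !unfold_in ?raddf0 ?raddfB //.
by move=> /eqP-> /eqP->; rewrite subrr.
Qed.
HB.instance Definition _ :=
  GRing.isZmodClosed.Build (C n) cocycle cocycle_zmod_closed.

Definition coboundary : {pred subzmod cocycle} :=
  fun z => `[< is_coboundary (val z) >].
Fact coboundary_zmod_closed : zmod_closed coboundary.
Proof.
split=> [|x y]; first exact/asboolP/is_coboundary0.
by move=> /asboolP xB /asboolP yB; apply/asboolP/is_coboundaryB.
Qed.
HB.instance Definition _ :=
  GRing.isZmodClosed.Build (subzmod cocycle) coboundary coboundary_zmod_closed.

Definition cohomology : zmodType := Quotient.quot coboundary.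

End Cohomology.

Section CohomologyMap.
Variables (C D : cochain_complex) (f : cochain_map C D) (n : nat).

Fact cmap_cocycle x : x \in @cocycle C n -> f n x \in @cocycle D n.
Proof. by rewrite !unfold_in -cmapE => /eqP->; rewrite raddf0. Qed.

Fact cmap_coboundary z :
  z \in @coboundary C n -> submap cmap_cocycle z \in @coboundary D n.
Proof.
by move=> /asboolP zB; apply/asboolP/is_coboundary_map.
Qed.

Definition cohomology_map : {additive cohomology C n -> cohomology D n} :=
  quotmap cmap_coboundary.

End CohomologyMap.

Section Subcomplex.
Variables (C : cochain_complex) (P : forall n, zmodClosed (C n)).
Hypothesis Pd : forall n (x : C n), x \in P n -> cdiff x \in P n.+1.

Fact subcomplex_diffK n (x : subzmod (P n)) :
  submap (@Pd n.+1) (submap (@Pd n) x) = 0.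
Proof. by apply/val_inj; rewrite /= cdiffK. Qed.

Definition subcomplex : cochain_complex := CochainComplex subcomplex_diffK.

Definition subcomplex_incl : cochain_map subcomplex C :=
  @CochainMap subcomplex C (fun n => \val) (fun n x => erefl).

End Subcomplex.

Section CompositeMap.
Variables (A B C : cochain_complex).
Variables (g : cochain_map B C) (f : cochain_map A B).

Fact cmap_compE n (x : A n) :
  (g n.+1 \o f n.+1) (cdiff x) = cdiff ((g n \o f n) x).
Proof. by rewrite /= !cmapE. Qed.

Definition cmap_comp : cochain_map A C :=
  @CochainMap A C (fun n => g n \o f n) cmap_compE.

End CompositeMap.

Section RestrictedMap.
Variables (C D : cochain_complex) (f : cochain_map C D).
Variables (P : forall n, zmodClosed (C n)) (Q : forall n, zmodClosed (D n)).
Hypothesis Pd : forall n (x : C n), x \in P n -> cdiff x \in P n.+1.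
Hypothesis Qd : forall n (x : D n), x \in Q n -> cdiff x \in Q n.+1.
Hypothesis fPQ : forall n (x : C n), x \in P n -> f n x \in Q n.

Fact cmap_restrE n (x : subzmod (P n)) :
  submap (@fPQ n.+1) (submap (@Pd n) x) = submap (@Qd n) (submap (@fPQ n) x).
Proof. by apply/val_inj; rewrite /= cmapE. Qed.

Definition cmap_restr : cochain_map (subcomplex Pd) (subcomplex Qd) :=
  @CochainMap (subcomplex Pd) (subcomplex Qd)
    (fun n => submap (@fPQ n)) cmap_restrE.

End RestrictedMap.

Record gmodule (G : groupType) := GModule {
  gmod_sort :> zmodType;
  gact : G -> {additive gmod_sort -> gmod_sort};
  gact1 : forall x, gact 1%g x = x;
  gactM : forall s t x, gact (s * t)%g x = gact s (gact t x) }.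

Section HomogeneousCochains.
Variables (G : groupType) (M : gmodule G).

(* Tuples are indexed from 0, as in (g_0, ..., g_n). *)
Definition omit n (j : 'I_n.+1) (g : n.+1.-tuple G) : n.-tuple G :=
  [tuple tnth g (lift j k) | k < n].

Definition exchange n (i : 'I_n) (g : n.+1.-tuple G) : n.+1.-tuple G :=
  [tuple tnth g (tperm (widen_ord (leqnSn n) i) (lift ord0 i) k) | k < n.+1].

Definition translate n (s : G) (g : n.-tuple G) : n.-tuple G :=
  [tuple (s * tnth g k)%g | k < n].

(* K^n is cut out below from the complex of all functions G^{n+1} -> M. *)
Section Differential.
Variable n : nat.

Definition hdiff (f : n.+1.-tuple G -> M) (g : n.+2.-tuple G) : M :=
  \sum_(j < n.+2) f (omit j g) *~ (-1) ^+ j.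

Fact hdiff_is_zmod_morphism : zmod_morphism hdiff.
Proof.
move=> f1 f2; apply/funext => g.
rewrite -[RHS]/(hdiff f1 g - hdiff f2 g) /hdiff -sumrB.
by apply: eq_bigr => j _; rewrite -mulrzBl.
Qed.
HB.instance Definition _ :=
  GRing.isZmodMorphism.Build _ _ hdiff hdiff_is_zmod_morphism.

End Differential.

Fact hdiffK n (f : n.+1.-tuple G -> M) : hdiff (hdiff f) = 0.
Proof.
apply/funext => g; rewrite /hdiff.
pose a (p : 'I_n.+3 * 'I_n.+2) : M :=
  f (omit p.2 (omit p.1 g)) *~ ((-1) ^+ p.2 * (-1) ^+ p.1).
transitivity (\sum_p a p).
  rewrite -(pair_bigA _ (fun i j => a (i, j))) /=; apply: eq_bigr => j _.
  by rewrite mulrz_suml; apply: eq_bigr => i _; rewrite -mulrzA.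
rewrite (bigID (fun p : 'I_n.+3 * 'I_n.+2 => p.1 <= p.2)%N) /=; apply/eqP; rewrite addr_eq0; apply/eqP.
pose h (p : 'I_n.+3 * 'I_n.+2) : 'I_n.+3 * 'I_n.+2 := (inord p.2.+1, inord p.1).
pose h' (p : 'I_n.+3 * 'I_n.+2) : 'I_n.+3 * 'I_n.+2 := (inord p.2, inord p.1.-1).
rewrite -sumrN [RHS](reindex_onto h h') /=; last first.
  move=> [j i] /=; rewrite -ltnNge => lt_ij.
  rewrite /h /h' /=; have [] := (ltn_ord i, ltn_ord j) => ? ?.
  by congr (_, _); apply/val_inj; rewrite /= ?inordK //; lia.
apply: eq_big => [[j i]|[j i]] /=.
  have [] := (ltn_ord i, ltn_ord j) => ? ?.
  rewrite /h /h' /=; apply/idP/andP => [le_ji|[lt_ji /eqP[/(congr1 val) /= E1 /(congr1 val) /= E2]]].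
    split; first by rewrite !inordK //; lia.
    by apply/eqP; congr (_, _); apply/val_inj; rewrite /= ?inordK //; lia.
  have lt_j : (j < n.+2)%N by rewrite -E1 inordK ?(leqW (ltn_ord _)) // ltn_ord.
  by move: lt_ji; rewrite !inordK //; lia.
move=> le_ji; have [] := (ltn_ord i, ltn_ord j) => ? ?.
rewrite /a /h /= -mulrNz; congr (f _ *~ _).
  apply: eq_from_tnth => k; rewrite !tnth_mktuple; congr (tnth g _).
  apply/val_inj; rewrite /= /bump !inordK //; last lia.
  by have := ltn_ord k; lia.
rewrite !inordK //; last lia.
by rewrite exprS mulN1r mulrN opprK mulrC.
Qed.

Definition fun_complex : cochain_complex :=
  @CochainComplex (fun n => n.+1.-tuple G -> M) (fun n => @hdiff n) hdiffK.

Definition homogeneous n : {pred fun_complex n} :=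
  fun f => `[< forall s g, f (translate s g) = gact M s (f g) >].
Fact homogeneous_zmod_closed n : zmod_closed (@homogeneous n).
Proof.
split=> [|x y]; first by apply/asboolP => s g; rewrite raddf0.
move=> /asboolP Hx /asboolP Hy; apply/asboolP => s g.
by rewrite !fctE Hx Hy raddfB.
Qed.
HB.instance Definition _ n :=
  GRing.isZmodClosed.Build (fun_complex n) (@homogeneous n)
    (@homogeneous_zmod_closed n).

Lemma tnth_translate n s (g : n.-tuple G) k :
  tnth (translate s g) k = (s * tnth g k)%g.
Proof. exact: tnth_mktuple. Qed.

Lemma omit_translate n j s (g : n.+1.-tuple G) :
  omit j (translate s g) = translate s (omit j g).
Proof. by apply: eq_from_tnth => k; rewrite !tnth_mktuple. Qed.

Lemma exchange_translate n i s (g : n.+1.-tuple G) :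
  exchange i (translate s g) = translate s (exchange i g).
Proof. by apply: eq_from_tnth => k; rewrite !tnth_mktuple. Qed.

Fact hdiff_homogeneous n (f : fun_complex n) :
  f \in @homogeneous n -> cdiff f \in @homogeneous n.+1.
Proof.
move=> /asboolP fE; apply/asboolP => s g; rewrite /= /hdiff raddf_sum.
by apply: eq_bigr => j _; rewrite omit_translate fE raddfMz.
Qed.

Definition Kcomplex : cochain_complex := subcomplex hdiff_homogeneous.

Lemma homogeneousP n (f : Kcomplex n) s g :
  val f (translate s g) = gact M s (val f g).
Proof. by case: f => f /= /asboolP. Qed.

Definition alternating n : {pred Kcomplex n} :=
  fun f => `[< forall (i : 'I_n) g, val f g = - val f (exchange i g) >].
Fact alternating_zmod_closed n : zmod_closed (@alternating n).
Proof.
split=> [|x y]; first by apply/asboolP => i g; rewrite oppr0.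
move=> /asboolP Hx /asboolP Hy; apply/asboolP => i g.
by rewrite /= !fctE (Hx i) (Hy i) opprD.
Qed.
HB.instance Definition _ n :=
  GRing.isZmodClosed.Build (Kcomplex n) (@alternating n)
    (@alternating_zmod_closed n).

Definition swapn i k : nat :=
  if k == i then i.+1 else if k == i.+1 then i else k.

Lemma tperm_swapn n (i : 'I_n) (k : 'I_n.+1) :
  tperm (widen_ord (leqnSn n) i) (lift ord0 i) k = swapn i k :> nat.
Proof.
rewrite permE /= /swapn -!val_eqE /= /bump /=.
by case: eqP => // _; case: eqP.
Qed.

Lemma omit_exchange_far n (i : 'I_n.+1) (j : 'I_n.+2) (i' : 'I_n) (g : n.+2.-tuple G) :
  (j < i /\ i = i'.+1 :> nat)%N \/ (i.+1 < j /\ i = i' :> nat)%N ->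
  omit j (exchange i g) = exchange i' (omit j g).
Proof.
move=> H; apply: eq_from_tnth => k; rewrite !tnth_mktuple; congr (tnth g _).
apply/val_inj; rewrite /= !tperm_swapn /=.
have [] := (ltn_ord i, ltn_ord j) => ? ?.
rewrite /swapn /bump; do ![case: eqP => ? //=]; lia.
Qed.

Lemma omit_exchange_near n (i : 'I_n.+1) (j : 'I_n.+2) (g : n.+2.-tuple G) :
  j = i :> nat \/ j = i.+1 :> nat ->
  omit j (exchange i g) = omit (tperm (widen_ord (leqnSn _) i) (lift ord0 i) j) g.
Proof.
move=> H; apply: eq_from_tnth => k; rewrite !tnth_mktuple; congr (tnth g _).
apply/val_inj; rewrite /= !tperm_swapn /=.
have [] := (ltn_ord i, ltn_ord j) => ? ?.
rewrite /swapn /bump; do ![case: eqP => ? //=]; lia.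
Qed.

Fact hdiff_alternating n (f : Kcomplex n) :
  f \in @alternating n -> cdiff f \in @alternating n.+1.
Proof.
move=> /asboolP fE; apply/asboolP => i g /=; rewrite /hdiff.
set t := tperm (widen_ord (leqnSn n.+1) i) (lift ord0 i).
rewrite -sumrN (reindex_inj (@perm_inj _ t)); apply: eq_bigr => j _.
have [] := (ltn_ord i, ltn_ord j) => ? ?.
have [near|far] := pselect (j = i :> nat \/ j = i.+1 :> nat).
  rewrite (omit_exchange_near _ near) -/t -mulrNz; congr (_ *~ _).
  rewrite tperm_swapn /swapn; case: eqVneq => [->|ne]; first by rewrite exprS mulN1r.
  have jE : j = i.+1 :> nat by case: near => // jE; rewrite jE eqxx in ne.
  by rewrite jE eqxx exprS mulN1r opprK.
have tj : t j = j.
  by apply/val_inj; rewrite /= tperm_swapn /swapn; do ![case: eqP => ? //=]; lia.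
rewrite tj -mulNrz; congr (_ *~ _).
suff [i' ->] : exists i', omit j (exchange i g) = exchange i' (omit j g).
  exact: fE.
have [lt_ji|le_ij] := ltnP j i.
  have i'P : (i.-1 < n)%N by lia.
  by exists (Ordinal i'P); apply: omit_exchange_far; left => /=; lia.
have i'P : (i < n)%N by lia.
by exists (Ordinal i'P); apply: omit_exchange_far; right => /=; lia.
Qed.

Definition KScomplex : cochain_complex := subcomplex hdiff_alternating.

Definition normalized n : {pred KScomplex n} :=
  fun f => `[< forall (i : 'I_n) (g : n.+1.-tuple G),
    tnth g (widen_ord (leqnSn n) i) = tnth g (lift ord0 i) ->
    val (val f) g = 0 >].
Fact normalized_zmod_closed n : zmod_closed (@normalized n).
Proof.
split=> [|x y]; first by apply/asboolP => i g.
move=> /asboolP Hx /asboolP Hy; apply/asboolP => i g gE.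
by rewrite /= !fctE (Hx i) // (Hy i) // subrr.
Qed.
HB.instance Definition _ n :=
  GRing.isZmodClosed.Build (KScomplex n) (@normalized n)
    (@normalized_zmod_closed n).

Fact hdiff_normalized n (f : KScomplex n) :
  f \in @normalized n -> cdiff f \in @normalized n.+1.
Proof.
move=> /asboolP f0; apply/asboolP => i g gE /=; rewrite /hdiff.
set w := widen_ord _ i in gE; set l := lift ord0 i in gE.
have wl : l != w by rewrite -val_eqE /= /bump; lia.
rewrite (bigD1 w) //= (bigD1 l) //= [X in _ + (_ + X)]big1 ?addr0 => [|j /andP[jw jl]].
  have -> : omit l g = omit w g.
    apply: eq_from_tnth => k; rewrite !tnth_mktuple.
    have [ki|ki] := eqVneq (k : nat) i.
      have -> : lift l k = w by apply/val_inj; rewrite /= /bump; lia.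
      by have -> : lift w k = l by apply/val_inj; rewrite /= /bump; lia.
    by congr (tnth g _); apply/val_inj; rewrite /= /bump; lia.
  by rewrite /bump leq0n add1n exprS mulN1r mulrNz subrr.
move: jw jl; rewrite -!val_eqE /= => jw jl.
have [] := (ltn_ord i, ltn_ord j) => ? ?; rewrite /bump leq0n add1n in jl.
pose i' := (if (j < i)%N then i.-1 else i).
have i'P : (i' < n)%N by rewrite /i'; case: ifP; lia.
rewrite (f0 (Ordinal i'P)) ?mul0rz // !tnth_mktuple.
have -> : lift j (widen_ord (leqnSn n) (Ordinal i'P)) = w.
  by apply/val_inj; rewrite /= /bump /i'; case: ifP; lia.
have -> // : lift j (lift ord0 (Ordinal i'P)) = l.
by apply/val_inj; rewrite /= /bump /i'; case: ifP; lia.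
Qed.

Definition Klambda : cochain_complex := subcomplex hdiff_normalized.

Definition Klambda_incl : cochain_map Klambda KScomplex :=
  subcomplex_incl hdiff_normalized.

End HomogeneousCochains.

Section InhomogeneousCochains.
Variables (G : groupType) (M : gmodule G).

(* The arguments (g_0, ..., g_n) of the differential keep their indices; the
   arguments (g_1, ..., g_n) of a cochain have theirs shifted down by one. *)
Definition merge n (j : nat) (g : n.+1.-tuple G) : n.-tuple G :=
  [tuple if (k.+1 < j)%N then nth 1%g g k
         else if k.+1 == j then (nth 1%g g k * nth 1%g g k.+1)%g
         else nth 1%g g k.+1 | k < n].

Definition omit_last n (g : n.+1.-tuple G) : n.-tuple G :=
  [tuple nth 1%g g k | k < n].

Section Differential.
Variable n : nat.

Definition idiff (phi : n.-tuple G -> M) (g : n.+1.-tuple G) : M :=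
  gact M (thead g) (phi (behead_tuple g))
  + \sum_(1 <= j < n.+1) phi (merge j g) *~ (-1) ^+ j
  + phi (omit_last g) *~ (-1) ^+ n.+1.

Fact idiff_is_zmod_morphism : zmod_morphism idiff.
Proof.
move=> f1 f2; apply/funext => g.
rewrite -[RHS]/(idiff f1 g - idiff f2 g) /idiff.
rewrite -[(f1 - f2) _]/(f1 _ - f2 _) raddfB -[(f1 - f2) _]/(f1 _ - f2 _) mulrzBl.
have -> : \sum_(1 <= j < n.+1) (f1 - f2) (merge j g) *~ (-1) ^+ j =
    \sum_(1 <= j < n.+1) f1 (merge j g) *~ (-1) ^+ j
    - \sum_(1 <= j < n.+1) f2 (merge j g) *~ (-1) ^+ j.
  by rewrite -sumrB; apply: eq_bigr => j _; rewrite -mulrzBl.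
by rewrite !opprD [in RHS]addrACA [in RHS](addrACA (gact _ _ _)).
Qed.
HB.instance Definition _ :=
  GRing.isZmodMorphism.Build _ _ idiff idiff_is_zmod_morphism.

End Differential.

Fact nth_ord_tuple n (F : 'I_n -> G) k (lt_kn : (k < n)%N) :
  nth 1%g [tuple F l | l < n] k = F (Ordinal lt_kn).
Proof. by rewrite -[k]/(val (Ordinal lt_kn)) nth_mktuple. Qed.

(* The entry at position k is g_1 ... g_k. *)
Definition partial_prods n (g : n.-tuple G) : n.+1.-tuple G :=
  [tuple (\prod_(l < k) nth 1 g l)%g | k < n.+1].

Definition quotients n (g : n.+1.-tuple G) : n.-tuple G :=
  [tuple ((nth 1 g k)^-1 * nth 1 g k.+1)%g | k < n].

Section Psi.
Variable n : nat.

Definition psi_fun (f : Kcomplex M n) (g : n.-tuple G) : M :=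
  val f (partial_prods g).

Fact psi_is_zmod_morphism : zmod_morphism psi_fun.
Proof. by []. Qed.
HB.instance Definition _ :=
  GRing.isZmodMorphism.Build _ _ psi_fun psi_is_zmod_morphism.

End Psi.

Lemma nth_partial_prods n (g : n.-tuple G) k : (k <= n)%N ->
  nth 1%g (partial_prods g) k = (\prod_(l < k) nth 1 g l)%g.
Proof.
by rewrite -ltnS => lt_kn; rewrite nth_ord_tuple.
Qed.

Lemma partial_prods_quotients n (g : n.+1.-tuple G) :
  translate (nth 1%g g 0) (partial_prods (quotients g)) = g.
Proof.
apply: eq_from_tnth => -[k lt_kn]; rewrite !tnth_mktuple (tnth_nth 1%g) /=.
elim: k lt_kn => [|k IHk] lt_kn; first by rewrite big_ord0 mulg1.
rewrite big_ord_recr mulgA IHk ?(ltnW lt_kn) // nth_ord_tuple /=.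
by rewrite mulgA mulgV mul1g.
Qed.

Lemma quotients_translate n s (g : n.+1.-tuple G) :
  quotients (translate s g) = quotients g.
Proof.
have nthE k : (k <= n)%N -> nth 1%g (translate s g) k = (s * nth 1 g k)%g.
  by rewrite -ltnS => lt_kn; rewrite nth_ord_tuple (tnth_nth 1%g).
apply: eq_from_tnth => k; rewrite !tnth_mktuple !nthE ?(ltnW (ltn_ord k)) //.
by rewrite invgM -mulgA mulKg.
Qed.

Lemma quotients_partial_prods n (g : n.-tuple G) :
  quotients (partial_prods g) = g.
Proof.
apply: eq_from_tnth => k; rewrite !tnth_mktuple (tnth_nth 1%g).
rewrite !nth_partial_prods ?(ltnW (ltn_ord k)) // big_ord_recr /=.
by rewrite mulgA mulVg mul1g.
Qed.

Lemma partial_prods0 n (g : n.-tuple G) : nth 1%g (partial_prods g) 0 = 1%g.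
Proof. by rewrite nth_partial_prods // big_ord0. Qed.

Fact psi_inv_subproof n (phi : n.-tuple G -> M) :
  (fun g : n.+1.-tuple G => gact M (nth 1%g g 0) (phi (quotients g))) \in @homogeneous G M n.
Proof.
apply/asboolP => s g; rewrite quotients_translate.
rewrite -!(tnth_nth 1%g _ ord0) tnth_translate gactM.
by [].
Qed.

Definition psi_inv n (phi : n.-tuple G -> M) : Kcomplex M n :=
  exist (fun f => f \in @homogeneous G M n) _ (psi_inv_subproof phi).

Lemma psi_funK n : cancel (@psi_fun n) (@psi_inv n).
Proof.
move=> f; apply/val_inj/funext => g /=.
by rewrite /psi_fun -homogeneousP partial_prods_quotients.
Qed.

Lemma psi_invK n : cancel (@psi_inv n) (@psi_fun n).
Proof.
move=> phi; apply/funext => g; rewrite /psi_fun /=.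
by rewrite partial_prods0 gact1 quotients_partial_prods.
Qed.

Lemma omit0_partial_prods n (g : n.+1.-tuple G) :
  omit ord0 (partial_prods g)
  = translate (thead g) (partial_prods (behead_tuple g)).
Proof.
apply: eq_from_tnth => k; rewrite !tnth_mktuple /= big_ord_recl /=.
congr (_ * _)%g; first by rewrite /thead (tnth_nth 1%g).
by apply: eq_bigr => l _; rewrite nth_behead.
Qed.

Lemma omit_max_partial_prods n (g : n.+1.-tuple G) :
  omit ord_max (partial_prods g) = partial_prods (omit_last g).
Proof.
apply: eq_from_tnth => k; rewrite !tnth_mktuple /=.
have := ltn_ord k => ?; rewrite /bump leqNgt ltn_ord /= add0n.
apply: eq_bigr => l _; have lt_ln : (l < n)%N by have := ltn_ord l; lia.
by rewrite nth_ord_tuple.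
Qed.

Lemma omit_partial_prods n (j : 'I_n.+2) (g : n.+1.-tuple G) :
  (0 < j)%N -> (j < n.+1)%N ->
  omit j (partial_prods g) = partial_prods (merge j g).
Proof.
move=> j_gt0 lt_jn; apply: eq_from_tnth => -[k lt_kn]; rewrite !tnth_mktuple /=.
elim: k lt_kn => [|k IHk] lt_kn; first by rewrite /bump leqNgt j_gt0 !big_ord0.
rewrite [RHS]big_ord_recr -(IHk (ltnW lt_kn)) nth_ord_tuple /=.
rewrite /bump; case: (ltngtP k.+1 j) => [lt|gt|eq].
- by rewrite leqNgt (ltn_trans _ lt) // !add0n big_ord_recr.
- by rewrite (_ : j <= k)%N // !add1n big_ord_recr.
- by rewrite -eq ltnn add1n add0n !big_ord_recr /= mulgA.
Qed.

Lemma idiff_psi n (f : Kcomplex M n) : idiff (psi_fun f) = psi_fun (cdiff f).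
Proof.
apply/funext => g; rewrite /idiff /psi_fun /= /hdiff.
rewrite big_ord_recl big_ord_recr /= expr0 addrA; congr (_ + _ + _).
- by rewrite omit0_partial_prods homogeneousP mulr1z.
- rewrite big_add1 /= big_mkord; apply: eq_bigr => i _.
  by rewrite omit_partial_prods //= /bump /= ltnS.
- rewrite (_ : lift ord0 ord_max = ord_max) ?omit_max_partial_prods //.
  exact/val_inj.
Qed.

Fact idiffK n (phi : n.-tuple G -> M) : idiff (idiff phi) = 0.
Proof. by rewrite -(psi_invK phi) !idiff_psi cdiffK raddf0. Qed.

Definition Ccomplex : cochain_complex :=
  @CochainComplex (fun n => n.-tuple G -> M) (fun n => @idiff n) idiffK.

Definition psi : cochain_map (Kcomplex M) Ccomplex :=
  @CochainMap (Kcomplex M) Ccomplex (fun n => @psi_fun n)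
    (fun n f => esym (idiff_psi f)).

(* The index i : 'I_n stands for the transposition (i+1, i+2) of {1, ..., n+1}.
   The three cases i = 1, 1 < i < n, i = n of the definition of tau_i differ
   only by the leading factor and by which neighbours of g_i exist. *)
Definition tau_arg n (i : 'I_n) (g : n.-tuple G) : n.-tuple G :=
  [tuple if k == i then (tnth g i)^-1%g
         else if k.+1 == i :> nat then (tnth g k * tnth g i)%g
         else if k == i.+1 :> nat then (tnth g i * tnth g k)%g
         else tnth g k | k < n].

Definition tau n (i : 'I_n) (phi : n.-tuple G -> M) (g : n.-tuple G) : M :=
  if i == 0 :> nat then - gact M (tnth g i) (phi (tau_arg i g))
  else - phi (tau_arg i g).

(* The tau_i generate the symmetric group, see symmetricP. *)
Definition symmetric n : {pred Ccomplex n} :=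
  fun phi => `[< forall i : 'I_n, tau i phi = phi >].

Fact symmetric_zmod_closed n : zmod_closed (@symmetric n).
Proof.
split=> [|x y].
  apply/asboolP => i; apply/funext => g; rewrite /tau raddf0 oppr0.
  by case: ifP => _ //; rewrite oppr0.
move=> /asboolP Hx /asboolP Hy; apply/asboolP => i; apply/funext => g.
rewrite -[RHS]/(x g - y g) -{2}(Hx i) -{2}(Hy i) /tau.
case: ifP => _; rewrite -[(x - y) _]/(x _ - y _) 1?(raddfB (gact _ _));
  by rewrite opprD.
Qed.
HB.instance Definition _ n :=
  GRing.isZmodClosed.Build (Ccomplex n) (@symmetric n)
    (@symmetric_zmod_closed n).

Lemma partial_prods_tau_arg n (i : 'I_n) (g : n.-tuple G) :
  translate (if i == 0 :> nat then tnth g i else 1%g) (partial_prods (tau_arg i g))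
  = exchange i (partial_prods g).
Proof.
apply: eq_from_tnth => -[k lt_kn]; rewrite !tnth_mktuple tperm_swapn /=.
pose p m := (\prod_(l < m) nth 1 g l)%g; rewrite -/(p _).
have pS m : p m.+1 = (p m * nth 1 g m)%g by rewrite /p big_ord_recr.
have p0 : p 0 = 1%g by rewrite /p big_ord0.
elim: k lt_kn => [|k IHk] lt_kn.
  rewrite big_ord0 mulg1 /swapn (tnth_nth 1%g) eq_sym.
  by case: (eqVneq 0 (i : nat)) => [<-|_]; rewrite ?pS p0 ?mul1g.
rewrite big_ord_recr mulgA IHk ?(ltnW lt_kn) // nth_ord_tuple /= -val_eqE /=.
rewrite !(tnth_nth 1%g) /= /swapn eqSS.
have [->|ki] := eqVneq k i.
  by rewrite (gtn_eqF (ltnSn i)) pS -mulgA mulgV mulg1.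
have [<-|k1i] := eqVneq k.+1 i.
  by rewrite (ltn_eqF (ltnW (ltnSn k.+1))) !pS mulgA.
case: eqP => [->|k1i']; last by rewrite pS.
by rewrite !pS mulgA.
Qed.

Lemma tau_psi n (i : 'I_n) (f : Kcomplex M n) g :
  tau i (psi_fun f) g = - val f (exchange i (partial_prods g)).
Proof.
rewrite -partial_prods_tau_arg homogeneousP /tau /psi_fun.
by case: ifP; rewrite ?gact1.
Qed.

Lemma psi_symmetric n (f : Kcomplex M n) :
  (psi n f \in @symmetric n) = (f \in @alternating G M n).
Proof.
apply/asboolP/asboolP => [fE i g|fE i]; last first.
  by apply/funext => g; rewrite [LHS]tau_psi -fE.
rewrite -(partial_prods_quotients g) exchange_translate !homogeneousP -raddfN.
by rewrite -tau_psi -[tau _ _]/(tau i (psi n f)) fE.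
Qed.

Fact idiff_symmetric n (phi : Ccomplex n) :
  phi \in @symmetric n -> cdiff phi \in @symmetric n.+1.
Proof.
rewrite -(psi_invK phi) -[psi_fun _]/(psi n _) -cmapE !psi_symmetric.
exact: hdiff_alternating.
Qed.

Definition CScomplex : cochain_complex := subcomplex idiff_symmetric.

Fact psi_alternating n (f : Kcomplex M n) :
  f \in @alternating G M n -> psi n f \in @symmetric n.
Proof. by rewrite psi_symmetric. Qed.

Definition psiS : cochain_map (KScomplex M) CScomplex :=
  cmap_restr (hdiff_alternating (M := M)) idiff_symmetric psi_alternating.

Definition Hlambda n : zmodType := cohomology (Klambda M) n.
Definition HS n : zmodType := cohomology CScomplex n.

Definition gamma n : {additive Hlambda n -> HS n} :=
  cohomology_map (cmap_comp psiS (Klambda_incl M)) n.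

End InhomogeneousCochains.

Section SymmetricGroupAction.
Variables (G : groupType) (M : gmodule G) (n : nat).

Let adj (i : 'I_n) : {perm 'I_n.+1} :=
  tperm (widen_ord (leqnSn n) i) (lift ord0 i).

Lemma adjacent_tperm_ind (P : {perm 'I_n.+1} -> Prop) :
  P 1%g -> (forall s t, P s -> P t -> P (s * t)%g) -> (forall i, P (adj i)) ->
  forall s, P s.
Proof.
move=> P1 PM Padj s.
have Plt d (x y : 'I_n.+1) : y = (x + d.+1)%N :> nat -> P (tperm x y).
  elim: d y => [|d IHd] y yE.
    have lt_xn : (x < n)%N by have := ltn_ord y; lia.
    have -> : tperm x y = adj (Ordinal lt_xn).
      by congr (tperm _ _); apply/val_inj => //=; rewrite yE /bump; lia.
    exact: Padj.
  have lt_zn : (x + d.+1 < n)%N by have := ltn_ord y; lia.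
  pose k := Ordinal lt_zn; pose z := widen_ord (leqnSn n) k.
  have yE' : y = lift ord0 k by apply/val_inj; rewrite /= yE /bump; lia.
  have xz : x != z by rewrite -val_eqE /=; lia.
  have xy : x != y by apply/eqP => xy; move: yE; rewrite xy; lia.
  have -> : tperm x y = (adj k * (tperm x z * adj k))%g.
    rewrite /adj -yE' -/z -{1}(tpermV z y) -conjgE tpermJ tpermL.
    by rewrite tpermD // eq_sym.
  by apply: (PM) => //; apply: (PM) => //; apply: IHd.
have Pt x y : P (tperm x y).
  case: (ltngtP x y) => [lt|gt|/val_inj ->]; last by rewrite tperm1.
    by apply: (Plt (y - x).-1); lia.
  by rewrite tpermC; apply: (Plt (x - y).-1); lia.
have [ts -> _] := prod_tpermP s.
by elim/big_ind: _ => //.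
Qed.

Let hact_fun (f : n.+1.-tuple G -> M) (s : {perm 'I_n.+1}) : n.+1.-tuple G -> M :=
  fun g => f [tuple tnth g (s k) | k < n.+1] *~ (-1) ^+ s.

Fact hact_homogeneous (f : Kcomplex M n) s :
  hact_fun (val f) s \in @homogeneous G M n.
Proof.
apply/asboolP => u g; rewrite /hact_fun raddfMz -homogeneousP.
by congr (val f _ *~ _); apply: eq_from_tnth => k; rewrite !tnth_mktuple.
Qed.

Let hact (f : Kcomplex M n) s : Kcomplex M n :=
  exist (fun f => f \in @homogeneous G M n) _ (hact_homogeneous f s).

Let sact (phi : n.-tuple G -> M) s := psi_fun (hact (psi_inv phi) s).

Fact sact1 phi : sact phi 1%g = phi.
Proof.
rewrite -[RHS]psi_invK; apply/funext => g.
rewrite /sact /psi_fun /= /hact_fun odd_perm1 expr0 mulr1z.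
have -> : [tuple tnth (partial_prods g) ((1%g : {perm 'I_n.+1}) k) | k < n.+1]
          = partial_prods g.
  by apply: eq_from_tnth => k; rewrite tnth_mktuple perm1.
by [].
Qed.

Fact sactM phi s t : sact phi (s * t)%g = sact (sact phi s) t.
Proof.
rewrite {2}/sact /sact psi_funK; apply/funext => g.
rewrite /psi_fun /= /hact_fun odd_permM signr_addb mulrzA.
congr (val (psi_inv phi) _ *~ _ *~ _).
by apply: eq_from_tnth => k; rewrite !tnth_mktuple permM.
Qed.

Fact sact_is_action : is_action [set: {perm 'I_n.+1}] sact.
Proof.
split=> [s phi1 phi2 /(congr1 (sact^~ s^-1%g))|phi s t _ _]; last exact: sactM.
by rewrite -!sactM mulgV !sact1.
Qed.

Lemma symmetricP :
  exists to : {action {perm 'I_n.+1} &-> (n.-tuple G -> M)},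
    (forall (i : 'I_n) phi,
       to phi (tperm (widen_ord (leqnSn n) i) (lift ord0 i)) = tau i phi)
    /\ (forall phi : Ccomplex M n,
          phi \in @symmetric G M n <-> forall s, to phi s = phi).
Proof.
have sact_tau i phi : sact phi (adj i) = tau i phi.
  rewrite -[in RHS](psi_invK phi); apply/funext => g; rewrite tau_psi.
  rewrite /sact /psi_fun /= /hact_fun odd_tperm.
  have -> : widen_ord (leqnSn n) i != lift ord0 i.
    by rewrite -val_eqE /= /bump; lia.
  by rewrite expr1 mulrNz.
exists (Action sact_is_action); split=> [//|phi]; split=> [/asboolP fix_tau|fix_s].
  apply: adjacent_tperm_ind => [|s t sE tE|i]; first exact: sact1.
    by rewrite /= sactM -[sact phi s]/(Action sact_is_action phi s) sE.
  by rewrite /= sact_tau.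
by apply/asboolP => i; rewrite -sact_tau; apply: fix_s.
Qed.

End SymmetricGroupAction.

(* Main.v *)
Require Import Defs.
From HB Require Import structures.
From mathcomp Require Import all_boot all_algebra.
From mathcomp Require Import perm generic_quotient ring_quotient zify.
From mathcomp Require Import boolp functions.

Import GRing.Theory.
Local Open Scope ring_scope.

(** The idea is that [gamma] already splits on the level of cochains.  Given an
    alternating cochain [f], let [rho f] agree with [f] on the tuples without
    repeated entries and vanish on all other tuples.  Then [rho f] is
    homogeneous, alternating and normalized, and [rho] fixes every normalized
    cochain, because a normalized alternating cochain vanishes on every tuple
    with a repetition ([normalized_repeat]).

    The one thing to see is that [rho] commutes with the differential
    ([rho_diff]).  On a tuple without repetitions every face is again without
    repetitions, so [d (rho f)] and [rho (d f)] agree there.  On a tuple with a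
    repetition both vanish, since both are normalized alternating cochains:
    here it matters that normalized cochains form a subcomplex.  Hence [rho],
    precomposed with the inverse of [psi], is a cochain map which induces the
    retraction of [gamma].

    If [M] has no elements of order two, an alternating cochain is normalized:
    exchanging two equal neighbours gives [f g = - f g].  So [rho] is the
    identity up to the inclusion of the normalized cochains, and the retraction
    of [gamma] is its two-sided inverse. *)

Lemma cohomology_map_pi (C D : cochain_complex) (f : cochain_map C D) (n : nat)
    (z : subzmod (@cocycle C n)) :
  cohomology_map f n (\pi_(Quotient.quot (@coboundary C n)) z)%qT =
  (\pi_(Quotient.quot (@coboundary D n)) (submap (@cmap_cocycle C D f n) z))%qT.
Proof. exact: quotmap_pi. Qed.

Lemma cohomology_mapK (C D : cochain_complex) (f : cochain_map C D)
    (g : cochain_map D C) (n : nat) :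
  cancel (f n) (g n) -> cancel (cohomology_map f n) (cohomology_map g n).
Proof.
move=> fK q.
have -> : q = (\pi_(Quotient.quot (@coboundary C n)) (repr q))%qT.
  by rewrite [RHS]reprK.
rewrite cohomology_map_pi cohomology_map_pi; apply: congr1.
by apply/val_inj; rewrite /= fK.
Qed.

Lemma cmap_compK (A B C : cochain_complex) (g : cochain_map B C)
    (f : cochain_map A B) (g' : cochain_map C B) (f' : cochain_map B A) (n : nat) :
  cancel (g n) (g' n) -> cancel (f n) (f' n) ->
  cancel (cmap_comp g f n) (cmap_comp f' g' n).
Proof. exact: can_comp. Qed.

Section RepetitionFree.
Variables (G : groupType) (M : gmodule G).

Lemma uniq_translate n (s : G) (g : n.-tuple G) :
  uniq (translate s g) = uniq g.
Proof.
apply/tuple_uniqP/tuple_uniqP => g_inj i j eq_ij; apply: g_inj.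
  by rewrite !tnth_translate eq_ij.
by move: eq_ij; rewrite !tnth_translate => /mulgI.
Qed.

Lemma exchangeK n (i : 'I_n) : involutive (@exchange G n i).
Proof.
by move=> g; apply: eq_from_tnth => k; rewrite !tnth_mktuple tpermK.
Qed.

Lemma uniq_exchange n (i : 'I_n) (g : n.+1.-tuple G) :
  uniq (exchange i g) = uniq g.
Proof.
have exch (h : n.+1.-tuple G) : uniq h -> uniq (exchange i h).
  move=> /tuple_uniqP h_inj; apply/tuple_uniqP => j k.
  by rewrite !tnth_mktuple => /h_inj/perm_inj.
by apply/idP/idP => [/exch|/exch //]; rewrite exchangeK.
Qed.

Lemma uniq_omit n (j : 'I_n.+1) (g : n.+1.-tuple G) :
  uniq g -> uniq (omit j g).
Proof.
move=> /tuple_uniqP g_inj; apply/tuple_uniqP => k l.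
by rewrite !tnth_mktuple => /g_inj/lift_inj.
Qed.

(** Transpositions of neighbours bring two equal entries of the tuple next to
    each other, at the cost of a sign only. *)
Lemma normalized_repeat n (f : Klambda M n) (g : n.+1.-tuple G) :
  ~~ uniq g -> val (val (val f)) g = 0.
Proof.
have norm := asboolP _ (valP f); have alt := asboolP _ (valP (val f)).
have repeat d : forall (x y : 'I_n.+1) h, y = (x + d.+1)%N :> nat ->
    tnth h x = tnth h y -> val (val (val f)) h = 0.
  elim: d => [|d IHd] x y h yE hxy.
    have lt_xn : (x < n)%N by have := ltn_ord y; lia.
    apply: (norm (Ordinal lt_xn)); congr (_ = _): hxy; congr (tnth h _).
      exact/val_inj.
    by apply/val_inj; rewrite /= yE /bump; lia.
  (* Exchange the entry at [y] with its left neighbour, at distance [d.+1]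
     from [x]. *)
  have lt_zn : (x + d.+1 < n)%N by have := ltn_ord y; lia.
  pose i := Ordinal lt_zn; rewrite (alt i); apply/eqP; rewrite oppr_eq0; apply/eqP.
  apply: (IHd x (widen_ord (leqnSn n) i)) => //.
  have -> : tnth (exchange i h) x = tnth h x.
    rewrite tnth_mktuple tpermD // -val_eqE /= ?/bump; lia.
  rewrite tnth_mktuple tpermL hxy; congr (tnth h _).
  by apply/val_inj; rewrite /= yE /bump; lia.
move=> /negP g_rep; apply: contra_notP g_rep => fg.
apply/tuple_uniqP => x y gxy; apply/val_inj/eqP; apply: contra_notT fg.
rewrite /=; case: ltngtP => // lt _.
  by apply: (repeat (y - x).-1 x y) => //; lia.
by apply: (repeat (x - y).-1 y x) => //; lia.
Qed.

Definition rho_fun n (f : KScomplex M n) : fun_complex M n :=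
  fun g => if uniq g then val (val f) g else 0.

Fact rho_homogeneous n (f : KScomplex M n) :
  rho_fun n f \in @homogeneous G M n.
Proof.
apply/asboolP => s g; rewrite /rho_fun uniq_translate homogeneousP.
by case: ifP; rewrite ?raddf0.
Qed.

Definition rho_hom n (f : KScomplex M n) : Kcomplex M n :=
  exist (fun h => h \in @homogeneous G M n) _ (rho_homogeneous n f).

Fact rho_alternating n (f : KScomplex M n) :
  rho_hom n f \in @alternating G M n.
Proof.
apply/asboolP => i g; rewrite /= /rho_fun uniq_exchange.
by case: ifP; rewrite ?oppr0 // -(asboolP _ (valP f)).
Qed.

Definition rho_alt n (f : KScomplex M n) : KScomplex M n :=
  exist (fun h => h \in @alternating G M n) _ (rho_alternating n f).

Fact rho_normalized n (f : KScomplex M n) :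
  rho_alt n f \in @normalized G M n.
Proof.
apply/asboolP => i g gE; rewrite /= /rho_fun; case: ifP => // /tuple_uniqP g_inj.
by have /(congr1 val) := g_inj _ _ gE; rewrite /= /bump; lia.
Qed.

Definition rho_n n (f : KScomplex M n) : Klambda M n :=
  exist (fun h => h \in @normalized G M n) _ (rho_normalized n f).

Fact rho_is_zmod_morphism n : zmod_morphism (rho_n n).
Proof.
move=> f1 f2; do 3!apply/val_inj; apply/funext => g.
rewrite /= /rho_fun -[RHS]/(rho_fun n f1 g - rho_fun n f2 g) /rho_fun.
by case: ifP => _; rewrite ?subrr.
Qed.
HB.instance Definition _ n :=
  GRing.isZmodMorphism.Build _ _ (rho_n n) (rho_is_zmod_morphism n).

(** On tuples with a repetition, the summands of the two differentials do not
    match one by one: the faces omitting one of two equal entries may contribute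
    to the right-hand side, where they cancel.  Applying [normalized_repeat]
    to both sides as wholes avoids this cancellation. *)
Lemma rho_diff n (f : KScomplex M n) : rho_n n.+1 (cdiff f) = cdiff (rho_n n f).
Proof.
do 3!apply/val_inj; apply/funext => g.
have [g_uniq|g_rep] := boolP (uniq g); last by rewrite !normalized_repeat.
rewrite /= /rho_fun g_uniq /= /hdiff; apply: eq_bigr => j _.
by rewrite uniq_omit.
Qed.

Definition rho : cochain_map (KScomplex M) (Klambda M) :=
  @CochainMap (KScomplex M) (Klambda M) rho_n rho_diff.

Lemma rhoK n : cancel (Klambda_incl M n) (rho n).
Proof.
move=> f; do 3!apply/val_inj; apply/funext => g.
rewrite /= /rho_fun; case: ifP => // /negbT g_rep.
by rewrite normalized_repeat.
Qed.

Lemma alternating_normalized n (f : KScomplex M n) :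
  (forall x : M, x *+ 2 = 0 -> x = 0) -> f \in @normalized G M n.
Proof.
move=> M2; apply/asboolP => i g gE; apply: M2.
rewrite mulr2n {1}(asboolP _ (valP f) i).
have -> : exchange i g = g.
  apply: eq_from_tnth => k; rewrite tnth_mktuple.
  by case: tpermP => // ->.
exact: addNr.
Qed.

Lemma rho_inclK n : (forall x : M, x *+ 2 = 0 -> x = 0) ->
  cancel (rho n) (Klambda_incl M n).
Proof.
move=> M2 f; have f_norm := alternating_normalized n f M2.
by rewrite -[f in LHS]/(Klambda_incl M n (exist _ f f_norm)) rhoK.
Qed.

Fact psi_inv_is_zmod_morphism n : zmod_morphism (@psi_inv G M n).
Proof.
by move=> a b; apply/val_inj/funext => g; rewrite /= -[RHS]raddfB.
Qed.
HB.instance Definition _ n :=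
  GRing.isZmodMorphism.Build _ _ (@psi_inv G M n) (psi_inv_is_zmod_morphism n).

Fact psi_inv_diff n (phi : Ccomplex M n) :
  psi_inv (cdiff phi) = cdiff (psi_inv phi : Kcomplex M n).
Proof. by rewrite -{1}(psi_invK phi) /= idiff_psi psi_funK. Qed.

Definition psi_inv_map : cochain_map (Ccomplex M) (Kcomplex M) :=
  @CochainMap (Ccomplex M) (Kcomplex M) (@psi_inv G M) psi_inv_diff.

Fact psi_inv_symmetric n (phi : Ccomplex M n) :
  phi \in @Defs.symmetric G M n -> psi_inv_map n phi \in @alternating G M n.
Proof. by rewrite -psi_symmetric /= psi_invK. Qed.

Definition psiS_inv : cochain_map (CScomplex M) (KScomplex M) :=
  cmap_restr (idiff_symmetric (M := M)) (hdiff_alternating (M := M))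
    psi_inv_symmetric.

Lemma psiSK n : cancel (@psiS G M n) (psiS_inv n).
Proof. by move=> f; apply/val_inj; rewrite /= psi_funK. Qed.

Lemma psiS_invK n : cancel (psiS_inv n) (psiS M n).
Proof. by move=> phi; apply/val_inj; rewrite /= psi_invK. Qed.

End RepetitionFree.

Theorem proposition3p6 (G : groupType) (M : gmodule G) (n : nat) :
  (exists r : {additive HS M n -> Hlambda M n}, cancel (gamma M n) r)
  /\ ((forall x : M, x *+ 2 = 0 -> x = 0) -> bijective (gamma M n)).
Proof.
pose r := cmap_comp (rho G M) (psiS_inv G M).
have gammaK : cancel (gamma M n) (cohomology_map r n).
  apply: cohomology_mapK; apply: cmap_compK; last exact: rhoK.
  exact: psiSK.
split=> [|M2]; first by exists (cohomology_map r n).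
exists (cohomology_map r n); first exact: gammaK.
apply: cohomology_mapK; apply: cmap_compK; last exact: psiS_invK.
exact: rho_inclK.
Qed.
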